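(* Let $\mathcal{M}$ be a first order structure. (i) If every group definable in $\mathcal{M}$ is solvable-by-finite, then every ring definable in $\mathcal{M}$ which has an identity element or has finite characteristic is nilpotent-by-finite. (ii) If every nilpotent group definable in $\mathcal{M}$ is abelian-by-finite, then every ring definable in $\mathcal{M}$ is null-by-finite. (iii) If every nilpotent group definable in $\mathcal{M}$ is (finite central)-by-abelian-by-finite, then every ring definable in $\mathcal{M}$ is (finite null)-by-null-by-finite.
   Context: ''Definable'' means definable (with parameters) in $\mathcal{M}$. Rings are associative, not necessarily commutative, and not assumed to contain $1$. A ring is nilpotent if $r_1\cdots r_n=0$ for all $r_1,\dots,r_n$ for some $n$; an element $r$ of a ring $R$ is null if $rR=Rr=\{0\}$, and a ring is null if all its elements are null. For $S\subseteq R$, $Ann_R(S)=\{r\in R: rS=Sr=\{0\}\}$. A group is abelian-by-finite [solvable-by-finite] if it has a normal abelian [solvable] subgroup of finite index. A ring is null-by-finite [nilpotent-by-finite] if it has a null [nilpotent] ideal of finite index. A group $G$ is (finite central)-by-abelian-by-finite if there are $H\lhd G$ and $K\lhd H$ with $G/H$ finite, $H/K$ abelian, and $K$ a finite subgroup of $Z(H)$. A ring $R$ is (finite null)-by-null-by-finite if there are an ideal $I$ of $R$ and an ideal $J$ of $I$ such that $R/I$ is finite, $I/J$ is null, and $J$ is a finite subring of $Ann_I(I)$. *)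

(* Defs.v *)
From HB Require Import structures.
From mathcomp Require Import all_boot all_algebra.
From mathcomp Require Import mathcomp_extra boolp classical_sets functions cardinality.

Set Implicit Arguments.
Unset Strict Implicit.
Unset Printing Implicit Defensive.

Local Open Scope classical_set_scope.

(** * First-order structures and definable sets *)

Record signature := Signature {
  fsym : Type;
  farity : fsym -> nat;
  rsym : Type;
  rarity : rsym -> nat }.

(* The universe is allowed to be empty. *)
Record structure (L : signature) := Structure {
  dom :> Type;
  fun_interp : forall f : fsym L, ('I_(farity f) -> dom) -> dom;
  rel_interp : forall r : rsym L, ('I_(rarity r) -> dom) -> Prop }.

(* Terms and formulas over an arbitrary type [V] of free variables; a quantifier
   adds the variable [None] to [V]. *)
Inductive term (L : signature) (V : Type) : Type :=
| Var of V
| App (f : fsym L) of ('I_(farity f) -> term L V).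

Inductive formula (L : signature) (V : Type) : Type :=
| Equal of term L V & term L V
| Rel (r : rsym L) of ('I_(rarity r) -> term L V)
| Not of formula L V
| And of formula L V & formula L V
| Exists of formula L (option V).

Fixpoint eval (L : signature) (M : structure L) (V : Type) (s : V -> M)
    (t : term L V) : M :=
  match t with
  | Var v => s v
  | App f ts => fun_interp (fun i => eval s (ts i))
  end.

Fixpoint sat (L : signature) (M : structure L) (V : Type) (phi : formula L V) :
    (V -> M) -> Prop :=
  match phi with
  | Equal t u => fun s => eval s t = eval s u
  | Rel r ts => fun s => rel_interp (fun i => eval s (ts i))
  | Not psi => fun s => ~ sat psi s
  | And psi chi => fun s => sat psi s /\ sat chi s
  | Exists psi => fun s => exists a : M, sat psi (oapp s a)
  end.

(* Definability with parameters, for subsets of M^I with I finite: a formula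
   with parameters is a formula whose variables are either coordinates [inl i]
   or elements [inr a] of M, the latter standing for themselves. *)
Definition definable (L : signature) (M : structure L) (I : finType)
    (A : set (I -> M)) : Prop :=
  exists phi : formula L (I + M),
    forall x : I -> M,
      A x <-> sat phi (fun v => match v with inl i => x i | inr a => a end).

Definition cat3 (T : Type) (n : nat) (x y z : 'I_n -> T) :
    'I_n + 'I_n + 'I_n -> T :=
  fun k => match k with inl (inl i) => x i | inl (inr i) => y i | inr i => z i end.

(* [c] identifies [T] with a subset of M^n. *)
Definition definable_carrier (L : signature) (M : structure L) (T : Type)
    (n : nat) (c : T -> 'I_n -> M) : Prop :=
  injective c /\ definable (range c).

Definition definable_op (L : signature) (M : structure L) (T : Type)
    (n : nat) (c : T -> 'I_n -> M) (op : T -> T -> T) : Prop :=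
  definable [set w | exists x y, w = cat3 (c x) (c y) (c (op x y))].

(** * Groups *)

Section Groups.
Local Open Scope group_scope.

Definition definable_group (L : signature) (M : structure L) (G : groupType) :
    Prop :=
  exists (n : nat) (c : G -> 'I_n -> M),
    definable_carrier c /\ definable_op c (fun x y : G => x * y).

Definition subgroup (G : groupType) (H : set G) : Prop :=
  [/\ H 1, forall x y, H x -> H y -> H (x * y) & forall x, H x -> H x^-1].

Definition normal_in (G : groupType) (K H : set G) : Prop :=
  [/\ subgroup K, subgroup H, K `<=` H &
      forall k h, K k -> H h -> K (h^-1 * k * h)].

Definition left_coset (G : groupType) (K : set G) (x : G) : set G :=
  [set x * k | k in K].

(* For K normal in H: finiteness and commutativity of H / K. *)
Definition finite_quotient (G : groupType) (H K : set G) : Prop :=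
  finite_set [set left_coset K x | x in H].

Definition abelian_quotient (G : groupType) (H K : set G) : Prop :=
  forall x y, H x -> H y -> left_coset K (x * y) = left_coset K (y * x).

Definition center_of (G : groupType) (H : set G) : set G :=
  [set z | H z /\ forall h, H h -> z * h = h * z].

Definition abelian_subgroup (G : groupType) (H : set G) : Prop :=
  forall x y, H x -> H y -> x * y = y * x.

Definition solvable_subgroup (G : groupType) (H : set G) : Prop :=
  exists (n : nat) (K : nat -> set G),
    [/\ K 0 = H, K n = [set 1] &
        forall i, (i < n)%N ->
          normal_in (K i.+1) (K i) /\ abelian_quotient (K i) (K i.+1)].

(* Existence of a central series. *)
Definition nilpotent_group (G : groupType) : Prop :=
  exists (n : nat) (K : nat -> set G),
    [/\ K 0 = [set: G], K n = [set 1],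
        forall i, (i <= n)%N -> normal_in (K i) [set: G] &
        forall i, (i < n)%N ->
          K i.+1 `<=` K i /\
          forall x g, K i x ->
            left_coset (K i.+1) (x * g) = left_coset (K i.+1) (g * x)].

Definition abelian_by_finite (G : groupType) : Prop :=
  exists H : set G,
    [/\ normal_in H [set: G], abelian_subgroup H & finite_quotient [set: G] H].

Definition solvable_by_finite (G : groupType) : Prop :=
  exists H : set G,
    [/\ normal_in H [set: G], solvable_subgroup H & finite_quotient [set: G] H].

Definition fincentral_by_abelian_by_finite (G : groupType) : Prop :=
  exists H K : set G,
    [/\ normal_in H [set: G], normal_in K H, finite_quotient [set: G] H,
        abelian_quotient H K & finite_set K /\ K `<=` center_of H].

End Groups.

(** * Rings, associative but not necessarily commutative or unital *)

Local Open Scope ring_scope.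

HB.mixin Record Zmodule_isRng R of GRing.Zmodule R := {
  rmul : R -> R -> R;
  rmulA : associative rmul;
  rmulDl : left_distributive rmul +%R;
  rmulDr : right_distributive rmul +%R }.

#[short(type="rngType")]
HB.structure Definition Rng := { R of Zmodule_isRng R & GRing.Zmodule R }.

Section Rings.
Local Notation "x ** y" := (rmul x y) (at level 40, left associativity).

Definition definable_ring (L : signature) (M : structure L) (R : rngType) :
    Prop :=
  exists (n : nat) (c : R -> 'I_n -> M),
    [/\ definable_carrier c, definable_op c (fun x y : R => x + y) &
        definable_op c (fun x y : R => x ** y)].

Definition has_identity (R : rngType) : Prop :=
  exists e : R, forall r : R, e ** r = r /\ r ** e = r.

Definition finite_characteristic (R : rngType) : Prop :=
  exists2 n : nat, (0 < n)%N & forall r : R, r *+ n = 0.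

Definition subring (R : rngType) (S : set R) : Prop :=
  [/\ S 0, forall x y, S x -> S y -> S (x + y), forall x, S x -> S (- x) &
      forall x y, S x -> S y -> S (x ** y)].

(* J is a two-sided ideal of the subring I of R. *)
Definition ideal_in (R : rngType) (J I : set R) : Prop :=
  [/\ subring J, subring I, J `<=` I &
      forall i j, I i -> J j -> J (i ** j) /\ J (j ** i)].

Definition add_coset (R : rngType) (J : set R) (x : R) : set R :=
  [set x + j | j in J].

(* For J an ideal of I: finiteness and nullity of the ring I / J. *)
Definition finite_rquotient (R : rngType) (I J : set R) : Prop :=
  finite_set [set add_coset J x | x in I].

Definition null_rquotient (R : rngType) (I J : set R) : Prop :=
  forall x y, I x -> I y -> add_coset J (x ** y) = add_coset J 0.

(* Ann_I(S) *)
Definition annihilator (R : rngType) (I S : set R) : set R :=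
  [set r | I r /\ forall s, S s -> r ** s = 0 /\ s ** r = 0].

(* Every element of the ring S is null in S. *)
Definition null_subring (R : rngType) (S : set R) : Prop :=
  forall r, S r -> forall s, S s -> r ** s = 0 /\ s ** r = 0.

(* rprod r n is the product of the n + 1 elements r 0, ..., r n. *)
Fixpoint rprod (R : rngType) (r : nat -> R) (n : nat) : R :=
  match n with
  | 0 => r 0%N
  | m.+1 => rprod r m ** r m.+1
  end.

Definition nilpotent_subring (R : rngType) (S : set R) : Prop :=
  exists n : nat, forall r : nat -> R, (forall i, S (r i)) -> rprod r n = 0.

Definition null_by_finite (R : rngType) : Prop :=
  exists I : set R,
    [/\ ideal_in I [set: R], null_subring I & finite_rquotient [set: R] I].

Definition nilpotent_by_finite (R : rngType) : Prop :=
  exists I : set R,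
    [/\ ideal_in I [set: R], nilpotent_subring I & finite_rquotient [set: R] I].

Definition finnull_by_null_by_finite (R : rngType) : Prop :=
  exists I J : set R,
    [/\ ideal_in I [set: R], ideal_in J I, finite_rquotient [set: R] I,
        null_rquotient I J & finite_set J /\ J `<=` annihilator I I].

End Rings.

(* Main.v *)
(** Write e_ij(a) for the elementary matrix 1 + a E_ij; then
    [e_ij(a), e_jk(b)] = e_ik(ab) turns commutators into products.

    (i) The group of quasi-invertible 3x3 matrices over R, with operation
    x + y + xy replacing (1 + x)(1 + y), is definable.  If H is a solvable
    normal subgroup of finite index, the a with e_ij(a) in H for all
    i <> j form a finite index subgroup of (R, +), which is an ideal because H is
    normal and is nilpotent because H is solvable.

    (ii), (iii) The Heisenberg group over R is definable and nilpotent.  The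
    hypothesis yields a finite index subgroup A of (R, +) with AA = 0,
    respectively with AA inside a finite subgroup F.  In the second case
    a(bc) = (ab)c lies in the finite set Fc, so after shrinking A all triple
    products vanish.  Finally every subring of finite index contains an ideal
    of finite index. *)

Require Import Defs.
From mathcomp Require Import all_boot all_algebra.
From HB Require Import structures.
From mathcomp Require Import mathcomp_extra boolp classical_sets functions cardinality.
Import GRing.Theory.

Set Implicit Arguments.
Unset Strict Implicit.
Unset Printing Implicit Defensive.

Local Open Scope classical_set_scope.
Local Open Scope ring_scope.

(** * Definable sets *)

Section Renaming.
Variable L : signature.

Fixpoint rename_term (V W : Type) (f : V -> W) (t : term L V) : term L W :=
  match t with
  | Var v => Var L (f v)
  | App g ts => App (fun i => rename_term f (ts i))
  end.

Fixpoint rename (V W : Type) (f : V -> W) (phi : formula L V) : formula L W :=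
  match phi with
  | Equal t u => Equal (rename_term f t) (rename_term f u)
  | Rel r ts => Rel (fun i => rename_term f (ts i))
  | Not psi => Not (rename f psi)
  | And psi chi => And (rename f psi) (rename f chi)
  | Exists psi => Exists (rename (omap f) psi)
  end.

Variable M : structure L.

Lemma eval_rename (V W : Type) (f : V -> W) (s : W -> M) t :
  eval s (rename_term f t) = eval (s \o f) t.
Proof. by elim: t => //= g ts IH; congr fun_interp; apply: funext. Qed.

Lemma sat_rename (V : Type) (phi : formula L V) (W : Type) (f : V -> W)
    (s : W -> M) : sat (rename f phi) s <-> sat phi (s \o f).
Proof.
elim: phi W f s => {V} [V t u|V r ts|V psi IH|V psi IHp chi IHc|V psi IH] W f s /=.
- by rewrite !eval_rename.
- by under eq_fun do rewrite eval_rename.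
- by rewrite IH.
- by rewrite IHp IHc.
- have E a : oapp s a \o omap f = oapp (s \o f) a by apply: funext; case.
  by split=> -[a H]; exists a; move: H; rewrite IH E.
Qed.

End Renaming.

Section Definability.
Variables (L : signature) (M : structure L).

(* [definable] over arbitrary index types, so that formulas with the variable
   types [option V] and [V + M] are covered as well. *)
Definition fo (V : Type) (P : set (V -> M)) : Prop :=
  exists phi : formula L (V + M), forall x : V -> M,
    P x <-> sat phi (fun v => match v with inl i => x i | inr a => a end).

Lemma fo_ext (V : Type) (P Q : set (V -> M)) :
  (forall x, Q x <-> P x) -> fo P -> fo Q.
Proof. by move=> PQ [phi Pphi]; exists phi => x; rewrite PQ. Qed.

(** Substitution of variables: as [f] is arbitrary, coordinates may be permuted, identified or
    added, while parameters stay fixed. *)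
Lemma fo_comp (V W : Type) (f : V -> W) (P : set (V -> M)) :
  fo P -> fo (fun x : W -> M => P (x \o f)).
Proof.
move=> [phi Pphi].
exists (rename (fun v => match v with inl i => inl (f i) | inr a => inr a end) phi).
move=> x; rewrite sat_rename Pphi.
by set s := (X in sat phi X); set t := (X in _ <-> sat phi X);
  have -> : s = t by apply: funext; case.
Qed.

Lemma fo_and (V : Type) (P Q : set (V -> M)) :
  fo P -> fo Q -> fo (fun x => P x /\ Q x).
Proof. by move=> [p Hp] [q Hq]; exists (And p q) => x; rewrite Hp Hq. Qed.

(** The quantified coordinate [inl None] of [option V + M] has to become the bound variable [None]
    of [option (V + M)]. *)
Lemma fo_ex (V : Type) (P : set (option V -> M)) :
  fo P -> fo (fun x : V -> M => exists a, P (oapp x a)).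
Proof.
move=> [phi Pphi].
exists (Exists (rename (fun v : option V + M =>
   match v with inl (Some i) => Some (inl i) | inl None => None
              | inr a => Some (inr a) end) phi)) => x /=.
split=> -[a H]; exists a; move: H; rewrite sat_rename Pphi;
  (set s := (X in sat phi X -> _); set t := (X in _ -> sat phi X);
   have -> : s = t by apply: funext => -[[]|]);
  by [].
Qed.

(** With an element at hand, [a = a] is true; over an empty universe every existential statement
    fails, so the negation of one serves. *)
Lemma fo_true (V : Type) : fo (fun _ : V -> M => True).
Proof.
case: (pselect (inhabited M)) => [[a]|M0].
  by exists (Equal (Var L (inr a)) (Var L (inr a))).
exists (Not (Exists (Equal (Var L None) (Var L None)))) => x /=.
by split=> // _ [a]; case: M0.
Qed.

Lemma fo_all (V : Type) (K : finType) (P : K -> set (V -> M)) :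
  (forall k, fo (P k)) -> fo (fun x => forall k, P k x).
Proof.
move=> FP.
suff H (s : seq K) : fo (fun x => forall k, k \in s -> P k x).
  apply: fo_ext (H (enum K)) => x; split=> [H' k _ //|H' k].
  by apply: H'; rewrite mem_enum.
elim: s => [|k s IH]; first by apply: fo_ext (fo_true V).
apply: fo_ext (fo_and (FP k) IH) => x; split.
  by move=> H; split=> [|j js]; apply: H; rewrite inE ?eqxx // js orbT.
by move=> [Pk Ps] j; rewrite inE => /predU1P [->|/Ps].
Qed.

Lemma fo_ex_tuple (n : nat) (V : Type) (P : set (V + 'I_n -> M)) :
  fo P ->
  fo (fun x : V -> M => exists y : 'I_n -> M,
        P (fun v => match v with inl i => x i | inr j => y j end)).
Proof.
elim: n V P => [|n IH] V P FP.
  pose f (v : V + 'I_0) : V :=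
    match v with inl i => i | inr j => False_rect V (notF (ltn_ord j)) end.
  apply: fo_ext (fo_comp f FP) => x.
  have E y : (fun v : V + 'I_0 => match v with inl i => x i | inr j => y j end)
      = x \o f by apply: funext => -[i //|[]].
  split=> [[y]|H]; first by rewrite E.
  by exists (fun j : 'I_0 => False_rect M (notF (ltn_ord j))); rewrite E.
(* Coordinate [ord0] becomes the outer quantifier; the others are shifted down for the induction
   hypothesis. *)
pose f (v : V + 'I_n.+1) : option V + 'I_n :=
  match v with
  | inl i => inl (Some i)
  | inr j => if unlift ord0 j is Some k then inr k else inl None
  end.
apply: fo_ext (fo_ex (IH _ _ (fo_comp f FP))) => x; split=> [[y Py]|[a [y]]].
  exists (y ord0), (y \o lift ord0); move: Py; congr P; apply: funext => -[i //|j] /=.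
  by case: unliftP => [k|] ->.
move=> Py; exists (fun j => if unlift ord0 j is Some k then y k else a).
move: Py; congr P; apply: funext => -[i //|j] /=.
by case: unliftP.
Qed.

End Definability.

(** * Polynomial relations over a definable ring *)

Section Interpretation.
Variable R : rngType.

(** Terms in 0, sum and product without other coefficients: their graphs can be defined from the
    graphs of the two ring operations. *)
Inductive polyfun (K : Type) : ((K -> R) -> R) -> Prop :=
| polyfun_var k : polyfun (fun r => r k)
| polyfun_zero : polyfun (fun=> 0)
| polyfun_add f g :
    polyfun f -> polyfun g -> polyfun (fun r => f r + g r)
| polyfun_mul f g :
    polyfun f -> polyfun g -> polyfun (fun r => rmul (f r) (g r)).

Lemma polyfun_sum (K I : Type) (s : seq I) (f : I -> (K -> R) -> R) :
  (forall i, polyfun (f i)) -> polyfun (fun r => \sum_(i <- s) f i r).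
Proof.
move=> Pf; elim: s => [|i s IH].
  by rewrite (_ : (fun _ => _) = fun=> 0);
    [exact: polyfun_zero | apply: funext => r; rewrite big_nil].
rewrite (_ : (fun _ => _) = fun r => f i r + \sum_(j <- s) f j r).
  exact: polyfun_add.
by apply: funext => r; rewrite big_cons.
Qed.

Variables (L : signature) (M : structure L) (n : nat) (c : R -> 'I_n -> M).
Hypothesis c_inj : injective c.
Hypothesis c_range : fo (range c).
Hypothesis c_add : definable_op c (fun x y : R => x + y).
Hypothesis c_mul : definable_op c (fun x y : R => rmul x y).

Definition code (K : Type) (r : K -> R) : K * 'I_n -> M := fun v => c (r v.1) v.2.

Lemma code_inj (K : Type) : injective (@code K).
Proof.
move=> r s rs; apply: funext => k; apply: c_inj; apply: funext => i.
exact: (congr1 (fun f => f (k, i)) rs).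
Qed.

Definition coded (K : Type) (Q : set (K -> R)) : Prop := fo (@code K @` Q).

Lemma coded_ext (K : Type) (P Q : set (K -> R)) :
  (forall r, Q r <-> P r) -> coded P -> coded Q.
Proof. by move=> PQ; rewrite (_ : Q = P) //; apply/seteqP; split=> r /PQ. Qed.

Lemma coded_true (K : finType) : coded [set: K -> R].
Proof.
have H : fo (fun w : K * 'I_n -> M => forall k, range c (w \o pair k)).
  by apply: fo_all => k; exact: fo_comp c_range.
apply: fo_ext H => w; split=> [[r _ <-] k|H]; first by exists (r k).
have /choice [r rE] : forall k, exists a, c a = w \o pair k.
  by move=> k; case: (H k) => a _; exists a.
by exists r => //; apply: funext => -[k i]; rewrite /code /= rE.
Qed.

(** Since the codes themselves form a definable set, a formula only has to be right on codes. *)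
Lemma coded_fo (K : finType) (Q : set (K -> R)) (P : set (K * 'I_n -> M)) :
  fo P -> (forall r, Q r <-> P (code r)) -> coded Q.
Proof.
move=> FP QP; apply: fo_ext (fo_and (coded_true K) FP) => w; split.
  by move=> [r Qr <-]; split; [exists r | apply/QP].
by move=> [[r _ <-] Pr]; exists r => //; apply/QP.
Qed.

Lemma fo_coded (K : Type) (Q : set (K -> R)) :
  coded Q -> exists2 P, fo P & forall r, Q r <-> P (code r).
Proof.
move=> CQ; exists (@code K @` Q) => // r; split=> [Qr|[s Qs /code_inj <-] //].
by exists r.
Qed.

Lemma coded_comp (K K' : finType) (f : K -> K') (Q : set (K -> R)) :
  coded Q -> coded (fun r : K' -> R => Q (r \o f)).
Proof.
move=> /fo_coded [P FP QP].
apply: (coded_fo (fo_comp (fun v : K * 'I_n => (f v.1, v.2)) FP)) => r.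
by rewrite QP.
Qed.

Lemma coded_and (K : finType) (P Q : set (K -> R)) :
  coded P -> coded Q -> coded (fun r => P r /\ Q r).
Proof.
move=> /fo_coded [p Fp Pp] /fo_coded [q Fq Qq].
by apply: (coded_fo (fo_and Fp Fq)) => r; rewrite Pp Qq.
Qed.

Lemma coded_all (K E : finType) (P : E -> set (K -> R)) :
  (forall e, coded (P e)) -> coded (fun r => forall e, P e r).
Proof.
move=> CP.
have H : fo (fun w : K * 'I_n -> M => forall e, (@code K @` P e) w).
  exact: fo_all.
apply: (coded_fo H) => r; split=> [Pr e|Pr e]; first by exists r.
by case: (Pr e) => s Ps /code_inj <-.
Qed.

Lemma coded_ex (K : finType) (Q : set (option K -> R)) :
  coded Q -> coded (fun r : K -> R => exists a, Q (oapp r a)).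
Proof.
move=> CQ.
pose f (v : option K * 'I_n) : K * 'I_n + 'I_n :=
  match v with (Some k, i) => inl (k, i) | (None, i) => inr i end.
apply: (coded_fo (fo_ex_tuple (fo_comp f CQ))) => r; split.
  move=> [a Qa]; exists (c a), (oapp r a) => //.
  by apply: funext => -[[k|] i].
(* Members of a coded set are codes, so the tuple [y] found over [M] is the code of an element of
   [R]. *)
move=> [y [s Qs sE]]; exists (s None); move: Qs; congr Q.
apply: funext => -[k|] //=; apply: c_inj; apply: funext => i.
exact: (congr1 (fun f => f (Some k, i)) sE).
Qed.

Lemma coded_op (op : R -> R -> R) (K : finType) (i j k : K) :
  definable_op c op -> coded (fun r : K -> R => op (r i) (r j) = r k).
Proof.
move=> Fop.
pose f (v : 'I_n + 'I_n + 'I_n) : K * 'I_n :=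
  match v with inl (inl a) => (i, a) | inl (inr a) => (j, a) | inr a => (k, a) end.
apply: (coded_fo (fo_comp f Fop)) => r; split.
  move=> E; exists (r i), (r j); rewrite E.
  by apply: funext => -[[a|a]|a].
move=> [x [y E]].
have Ei : r i = x.
  by apply: c_inj; apply: funext => a; exact: (congr1 (fun g => g (inl (inl a))) E).
have Ej : r j = y.
  by apply: c_inj; apply: funext => a; exact: (congr1 (fun g => g (inl (inr a))) E).
rewrite Ei Ej; apply: c_inj; apply: funext => a.
exact/esym/(congr1 (fun g => g (inr a)) E).
Qed.

(** Induction on the polynomial, with existential quantifiers naming the intermediate values. Inputs
    are read through [h] and the result at [k], so that variables can be added during the
    induction. *)
Lemma coded_polyfun (K K' : finType) (f : (K -> R) -> R) (h : K -> K') (k : K') :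
  polyfun f -> coded (fun r : K' -> R => f (r \o h) = r k).
Proof.
have fop (op : R -> R -> R) (g1 g2 : (K -> R) -> R) :
    definable_op c op ->
    (forall (K' : finType) (h : K -> K') k,
        coded (fun r : K' -> R => g1 (r \o h) = r k)) ->
    (forall (K' : finType) (h : K -> K') k,
        coded (fun r : K' -> R => g2 (r \o h) = r k)) ->
    forall (K' : finType) (h : K -> K') k,
        coded (fun r : K' -> R => op (g1 (r \o h)) (g2 (r \o h)) = r k).
  move=> Fop C1 C2 {}K' {}h {}k.
  have := coded_ex (coded_ex (coded_and
    (C1 _ (Some \o (Some \o h)) (Some None))
    (coded_and (C2 _ (Some \o (Some \o h)) None)
       (coded_op (Some None) None (Some (Some k)) Fop)))).
  apply: coded_ext => r; split=> [E|[a [b [/= <- [/= <- <-]]]] //].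
  by exists (g1 (r \o h)), (g2 (r \o h)).
(* Zero is definable from addition as the only solution of a + a = a. *)
have addrr0 (a : R) : a + a = a -> a = 0.
  by move=> E; apply: (addrI a); rewrite E addr0.
have C0 (K1 : finType) (j : K1) : coded (fun r : K1 -> R => 0 = r j).
  by apply: coded_ext (coded_op j j j c_add) => r; split=> [<-|/addrr0 ->]; rewrite ?addr0.
move=> pf; elim: pf K' h k => {f} [j||f g _ IHf _ IHg|f g _ IHf _ IHg] K' h k.
- have := coded_ex (coded_and (C0 _ None)
                      (coded_op (Some (h j)) None (Some k) c_add)).
  apply: coded_ext => r; split=> [/= <-|[a [/= <- <-]]]; last by rewrite addr0.
  by exists 0; rewrite addr0.
- exact: C0.
- exact: fop c_add IHf IHg _ _ _.
- exact: fop c_mul IHf IHg _ _ _.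
Qed.

Lemma coded_polyfun_eq (K : finType) (f g : (K -> R) -> R) :
  polyfun f -> polyfun g -> coded (fun r => f r = g r).
Proof.
move=> Pf Pg.
apply: coded_ext (coded_ex (coded_and (coded_polyfun Some None Pf)
                                      (coded_polyfun Some None Pg))) => r.
by split=> [E|[a [/= -> ->]] //]; exists (f r).
Qed.

End Interpretation.

(** An algebraic group over [R]: equations cut the carrier out of the [K]-tuples and polynomials
    give the multiplication, so both are definable through codes in [M]. *)
Lemma definable_algebraic_group (L : signature) (M : structure L) (R : rngType)
    (G : groupType) (K E : finType) (g : G -> K -> R)
    (p q : E -> (K -> R) -> R) (m : K -> (K + K -> R) -> R) :
  definable_ring M R -> injective g ->
  (forall e, polyfun (p e)) -> (forall e, polyfun (q e)) ->
  (forall k, polyfun (m k)) ->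
  (forall r, range g r <-> forall e, p e r = q e r) ->
  (forall x y k, g (x * y)%g k =
     m k (fun v => match v with inl i => g x i | inr i => g y i end)) ->
  definable_group M G.
Proof.
move=> [n [c [[c_inj c_range] c_add c_mul]]] g_inj Pp Pq Pm g_range gM.
have Crange : coded c (range g).
  apply: coded_ext g_range _; apply: coded_all => // e.
  exact: coded_polyfun_eq.
(* Carriers are indexed by ordinals, so the pairs in [K * 'I_n] are enumerated. *)
pose N := #|{: K * 'I_n}|.
pose d (x : G) (i : 'I_N) : M := code c (g x) (enum_val i).
have dE x (v : K * 'I_n) : d x (enum_rank v) = code c (g x) v.
  by rewrite /d enum_rankK.
exists N, d; split; first split.
- move=> x y dxy; apply/g_inj/(code_inj c_inj); apply: funext => v.
  by rewrite -!dE dxy.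
- apply: fo_ext (fo_comp enum_rank Crange) => w; split.
    by move=> [x _ <-]; exists (g x); [exists x | apply: funext => v /=; rewrite dE].
  move=> [_ [x _ <-] xE]; exists x => //; apply: funext => i.
  by rewrite /d xE /= enum_valK.
(* Only the two factors are required to be points; the equations with [m] force the third tuple to
   be their product. *)
have Cop : coded c (fun r : K + K + K -> R =>
    (range g (r \o (inl \o inl)) /\ range g (r \o (inl \o inr))) /\
    forall k, m k (r \o inl) = r (inr k)).
  apply: coded_and => //; last first.
    by apply: coded_all => // k; exact: coded_polyfun.
  by apply: coded_and => //; apply: (coded_comp c_inj c_range _ Crange).
pose f (v : (K + K + K) * 'I_n) : 'I_N + 'I_N + 'I_N :=
  match v with
  | (inl (inl k), i) => inl (inl (enum_rank (k, i)))
  | (inl (inr k), i) => inl (inr (enum_rank (k, i)))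
  | (inr k, i) => inr (enum_rank (k, i))
  end.
apply: fo_ext (fo_comp f Cop) => w; split.
  move=> [x [y ->]].
  exists (fun v => match v with inl (inl k) => g x k | inl (inr k) => g y k
                            | inr k => g (x * y)%g k end).
    split; first by split; [exists x | exists y].
    by move=> k; rewrite gM; congr (m k _); apply: funext => -[].
  by apply: funext => -[[[k|k]|k] i] /=; rewrite dE.
move=> [r [[[x _ xE] [y _ yE]] rE] wE]; exists x, y; apply: funext => v.
have zE : r \o inr = g (x * y)%g.
  apply: funext => k; rewrite /= -rE gM; congr (m k _); apply: funext => -[] j.
    by rewrite xE.
  by rewrite yE.
have wf j : w (f j) = code c r j by rewrite wE.
case: v => [[i|i]|i]; rewrite /cat3 /d -[i in LHS]enum_valK;
  case: (enum_val i) => k a.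
- by rewrite (wf (inl (inl k), a)) xE.
- by rewrite (wf (inl (inr k), a)) yE.
- by rewrite (wf (inr k, a)) -zE.
Qed.

(** * Subgroups of finite index *)

(** The position of [h x] in a list of all values serves as [f x]; the successor in the type makes
    [inord] available even for an empty list. *)
Lemma finite_range_code (X : Type) (U : eqType) (h : X -> U) :
  finite_set (range h) ->
  exists (T : finType) (f : X -> T), forall x y, f x = f y -> h x = h y.
Proof.
move=> /finite_seqP [s sE].
have hs x : h x \in s by have : range h (h x) by []; rewrite sE.
exists 'I_(size s).+1, (fun x => inord (index (h x) s)) => x y /(congr1 val) /=.
rewrite !inordK ?ltnS ?index_size // => E.
by rewrite -(nth_index (h x) (hs x)) E nth_index.
Qed.

Lemma left_coset_eq (G : groupType) (K : set G) (x y : G) :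
  subgroup K -> left_coset K x = left_coset K y -> K (y^-1 * x)%g.
Proof.
move=> [K1 _ _] E; have [k Kk <-] : left_coset K y x.
  by rewrite -E; exists 1%g; rewrite ?mulg1.
by rewrite mulKg.
Qed.

Lemma finite_quotient_code (G : groupType) (H : set G) :
  subgroup H -> finite_quotient [set: G] H ->
  exists (T : finType) (f : G -> T),
    forall x y, f x = f y -> H (x^-1 * y)%g.
Proof.
move=> sH /finite_range_code [T [f fP]]; exists T, f => x y /fP /esym.
exact: left_coset_eq.
Qed.

Section FiniteIndex.
Variable V : zmodType.
Implicit Types A B : set V.

Definition add_subgroup A : Prop := A 0 /\ forall x y, A x -> A y -> A (x - y).

(** A finite colouring in which elements of equal colour differ by an element of [A]. It need not be
    constant on cosets, so colourings for several sets combine by taking tuples. *)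
Definition finite_index A : Prop :=
  exists (T : finType) (f : V -> T), forall x y, f x = f y -> A (x - y).

Lemma add_subgroupN A x : add_subgroup A -> A x -> A (- x).
Proof. by move=> [A0 AB] Ax; rewrite -sub0r; exact: AB. Qed.

Lemma add_subgroupD A x y : add_subgroup A -> A x -> A y -> A (x + y).
Proof.
by move=> sA Ax Ay; rewrite -[y]opprK; apply: sA.2 => //; exact: add_subgroupN.
Qed.

Lemma finite_index_all (K : finType) (A : K -> set V) :
  (forall k, finite_index (A k)) -> finite_index (fun x => forall k, A k x).
Proof.
move=> fiA; pose T k := projT1 (cid (fiA k)).
pose f k : V -> T k := projT1 (cid (projT2 (cid (fiA k)))).
exists {dffun forall k, T k}, (fun x => [ffun k => f k x]) => x y E k.
apply: (projT2 (cid (projT2 (cid (fiA k))))).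
by move/ffunP/(_ k): E; rewrite !ffunE.
Qed.

Lemma finite_index_setI A B :
  finite_index A -> finite_index B -> finite_index (A `&` B).
Proof.
move=> [T [f fP]] [U [g gP]]; exists (T * U)%type, (fun x => (f x, g x)).
by move=> x y [/fP Axy /gP].
Qed.

Lemma fiber_representatives (X : Type) (T : Type) (f : X -> T) (x0 : X) :
  exists rep : T -> X, forall x, f (rep (f x)) = f x.
Proof.
have /choice [rep repP] : forall t, exists y, forall x, f x = t -> f y = t.
  move=> t; case: (pselect (exists x, f x = t)) => [[y yt]|nt]; first by exists y.
  by exists x0 => x xt; case: nt; exists x.
by exists rep => x; exact: (repP _ x).
Qed.

(** Subtracting the representative of its colour class moves an element into [A], where [g] applies;
    elements of one class share the representative, which cancels in the difference. *)
Lemma finite_index_trans A B :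
  finite_index A ->
  (exists (T : finType) (g : V -> T),
     forall x y, A x -> A y -> g x = g y -> B (x - y)) ->
  finite_index B.
Proof.
move=> [T [f fP]] [U [g gP]].
have [rep repP] := fiber_representatives f 0.
exists (T * U)%type, (fun x => (f x, g (x - rep (f x)))) => x y [fxy gxy].
have Arep z : A (z - rep (f z)) by apply: fP.
have -> : x - y = (x - rep (f x)) - (y - rep (f y)).
  by rewrite fxy opprB addrA subrK.
exact: gP.
Qed.

(* For x in A, the map r |-> mul r x + A only depends on r mod A. *)
Lemma finite_index_conductor (mul : V -> V -> V) A :
  left_distributive mul +%R -> right_distributive mul +%R ->
  add_subgroup A -> (forall x y, A x -> A y -> A (mul x y)) -> finite_index A ->
  finite_index (fun x => A x /\ forall r, A (mul r x)).
Proof.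
move=> mulDl mulDr sA AM [T [f fP]].
have [rep repP] := fiber_representatives f 0.
have mulBr r x y : mul r (x - y) = mul r x - mul r y.
  by apply/esym/eqP; rewrite subr_eq -mulDr subrK.
exists (T * {ffun T -> T})%type, (fun x => (f x, [ffun t => f (mul (rep t) x)])).
move=> x y [fxy /ffunP gxy]; split=> [|r]; first exact: fP.
have -> : mul r (x - y) = mul (r - rep (f r)) (x - y) + mul (rep (f r)) (x - y).
  by rewrite -mulDl subrK.
apply: add_subgroupD => //.
  by apply: AM; apply: fP.
by rewrite mulBr; apply: fP; have := gxy (f r); rewrite !ffunE.
Qed.

End FiniteIndex.

(** * Ideals from additive subgroups of finite index *)

Section FiniteIndexRing.
Variable R : rngType.
Local Notation "x ** y" := (@rmul R x y) (at level 40, left associativity).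
Implicit Types A S : set R.

Lemma rmulr0 x : x ** 0 = 0.
Proof. by apply: (addrI (x ** 0)); rewrite -rmulDr !addr0. Qed.

Lemma rmul0r x : 0 ** x = 0.
Proof. by apply: (addrI (0 ** x)); rewrite -rmulDl !addr0. Qed.

Lemma rmulrN x y : x ** (- y) = - (x ** y).
Proof. by apply: (addrI (x ** y)); rewrite -rmulDr !subrr rmulr0. Qed.

Lemma rmulNr x y : (- x) ** y = - (x ** y).
Proof. by apply: (addrI (x ** y)); rewrite -rmulDl !subrr rmul0r. Qed.

Lemma rmulBr x y z : x ** (y - z) = x ** y - x ** z.
Proof. by rewrite rmulDr rmulrN. Qed.

Lemma rmulBl x y z : (x - y) ** z = x ** z - y ** z.
Proof. by rewrite rmulDl rmulNr. Qed.

Lemma finite_index_rquotient A :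
  add_subgroup A -> finite_index A -> finite_rquotient [set: R] A.
Proof.
move=> sA [T [f fP]].
have cosetE x y : f x = f y -> add_coset A x `<=` add_coset A y.
  move=> /fP Axy _ [a Aa <-]; exists ((x - y) + a); first exact: add_subgroupD.
  by rewrite addrA [y + _]addrC subrK.
(* For a colour that occurs, [h t] is the common coset of all elements of that colour, so the cosets
   lie in the image of a finite type. *)
pose h (t : T) : set R := [set z | exists2 x, f x = t & add_coset A x z].
apply: (@sub_finite_set _ _ (range h)); last first.
  exact/finite_image/finite_finset.
move=> _ [x _ <-]; exists (f x) => //; apply/seteqP; split=> z.
  by move=> [y yx]; exact: cosetE.
by exists x.
Qed.

Lemma subringP S :
  subring S <-> add_subgroup S /\ forall x y, S x -> S y -> S (x ** y).
Proof.
split=> [[S0 SD SN SM]|[sS SM]].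
  by split=> //; split=> // x y Sx Sy; apply: SD => //; exact: SN.
by split=> //; [exact: sS.1 | move=> x y; exact: add_subgroupD |
  move=> x; exact: add_subgroupN].
Qed.

Lemma ideal_inP (I : set R) :
  ideal_in I [set: R] <->
  add_subgroup I /\ forall r x, I x -> I (r ** x) /\ I (x ** r).
Proof.
split=> [[/subringP [sI _] _ _ Iid]|[sI Iid]].
  by split=> // r x; exact: Iid.
split=> //; first by apply/subringP; split=> // x y Ix Iy; exact: (Iid _ _ Iy).1.
by move=> i j _; exact: Iid.
Qed.

(** Two conductors in turn: the x in [S] with Rx inside [S] form a left ideal [I1], and the x in
    [I1] with xR inside [I1] form a two-sided ideal. *)
Lemma finite_index_subring_ideal S :
  subring S -> finite_index S ->
  exists I : set R, [/\ ideal_in I [set: R], I `<=` S & finite_index I].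
Proof.
move=> /subringP [sS SM] fS.
pose I1 := [set x | S x /\ forall r, S (r ** x)].
have fI1 : finite_index I1.
  exact: (finite_index_conductor (@rmulDl R) (@rmulDr R)).
have sI1 : add_subgroup I1.
  split; first by split=> [|r]; rewrite ?rmulr0; exact: sS.1.
  move=> x y [Sx Rx] [Sy Ry]; split=> [|r]; first exact: sS.2.
  by rewrite rmulBr; exact: sS.2.
have I1M r x : I1 x -> I1 (r ** x).
  by move=> [_ Sx]; split=> [//|s]; rewrite rmulA.
pose I := [set x | I1 x /\ forall r, I1 (x ** r)].
exists I; split.
- apply/ideal_inP; split.
    split; first by split=> [|r]; rewrite ?rmul0r; exact: sI1.1.
    move=> x y [Sx Rx] [Sy Ry]; split=> [|r]; first exact: sI1.2.
    by rewrite rmulBl; exact: sI1.2.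
  move=> r x [Ix xR]; split; split=> [|s] //; first exact: I1M.
    by rewrite -rmulA; exact: I1M.
  by rewrite -rmulA; exact: xR.
- by move=> x [[]].
(* The second conductor is taken for the opposite multiplication, under which the left ideal [I1] is
   closed. *)
apply: (finite_index_conductor (mul := fun x y => y ** x)) => //.
- by move=> x y z; rewrite rmulDr.
- by move=> x y z; rewrite rmulDl.
- by move=> x y Ix _; exact: I1M.
Qed.

(** As AA = 0, the subgroup [A] is a subring, and an ideal inside it inherits the vanishing
    products. *)
Lemma null_by_finite_of_subgroup A :
  add_subgroup A -> finite_index A -> (forall x y, A x -> A y -> x ** y = 0) ->
  null_by_finite R.
Proof.
move=> sA fA A0.
have [] := @finite_index_subring_ideal A; rewrite ?subringP //.
  by split=> // x y Ax Ay; rewrite A0 //; exact: sA.1.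
move=> I [Iid IA fI]; exists I; split=> //; last first.
  by apply: finite_index_rquotient => //; case/ideal_inP: Iid.
by move=> r /IA Ar s /IA As; rewrite !A0.
Qed.

(* For fixed b, c in A, the products a (b c) = (a b) c lie in the finite set
   F c, and there are only finitely many values b c. *)
Lemma finite_index_annihilator_products A (F : set R) :
  add_subgroup A -> finite_index A -> finite_set F ->
  (forall x y, A x -> A y -> F (x ** y)) ->
  finite_index (fun x => A x /\
    forall b c, A b -> A c -> x ** (b ** c) = 0 /\ (b ** c) ** x = 0).
Proof.
move=> sA fA finF AF; have [s FE] := (finite_seqP _).1 finF.
have AFs x y : A x -> A y -> x ** y \in s.
  by move=> Ax Ay; have := AF _ _ Ax Ay; rewrite FE.
pose num (z : R) : 'I_(size s).+1 := inord (index z s).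
have num_inj z t : z \in s -> t \in s -> num z = num t -> z = t.
  move=> zs ts /(congr1 val) /=; rewrite !inordK ?ltnS ?index_size // => E.
  by rewrite -(nth_index 0 zs) E nth_index.
(* [p u] is a fixed factorisation of the product numbered [u]; numbers that do not occur get the
   default [(0, 0)]. *)
have /choice [p pP] : forall u : 'I_(size s).+1, exists p : R * R,
    [/\ A p.1, A p.2 & forall x y, A x -> A y ->
        num (x ** y) = u -> x ** y = p.1 ** p.2].
  move=> u; case: (pselect (exists b c, [/\ A b, A c & num (b ** c) = u])).
    move=> [b [c [Ab Ac bcu]]]; exists (b, c); split=> // x y Ax Ay xyu.
    by apply: num_inj; [exact: AFs | exact: AFs | rewrite xyu].
  move=> N; exists (0, 0); split; try exact: sA.1.
  by move=> x y Ax Ay E; case: N; exists x, y.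
apply: finite_index_trans fA _.
exists ({ffun 'I_(size s).+1 -> 'I_(size s).+1 * 'I_(size s).+1})%type.
(* The second component handles the other side, through (b c) x = b (c x). *)
exists (fun x => [ffun u => (num (x ** (p u).1), num ((p u).2 ** x))]).
move=> x y Ax Ay /ffunP xy; split=> [|b c Ab Ac]; first exact: sA.2.
have := xy (num (b ** c)); rewrite !ffunE.
have [] := pP (num (b ** c)); set d := p _ => Ad1 Ad2 /(_ b c Ab Ac erefl) ->.
move=> [/num_inj E1 /num_inj E2].
have {}E1 : (x - y) ** d.1 = 0 by rewrite rmulBl E1 ?subrr //; exact: AFs.
have {}E2 : d.2 ** (x - y) = 0 by rewrite rmulBr E2 ?subrr //; exact: AFs.
by rewrite rmulA E1 rmul0r -rmulA E2 rmulr0.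
Qed.

(** [A] is shrunk to [A'] with vanishing triple products, then enlarged by a finite [F'] containing
    the products to a subring [S]. An ideal [I] inside [S] and the intersection of [F'] with [I] are
    the witnesses. *)
Lemma finnull_by_null_by_finite_of_subgroup A (F : set R) :
  add_subgroup A -> finite_index A -> add_subgroup F -> finite_set F ->
  (forall x y, A x -> A y -> F (x ** y)) -> finnull_by_null_by_finite R.
Proof.
move=> sA fA sF finF AF.
pose annih (X : set R) := [set r | forall s, X s -> r ** s = 0 /\ s ** r = 0].
have annihB X : add_subgroup (annih X).
  split=> [s _|x y Xx Xy s Xs]; first by rewrite rmulr0 rmul0r.
  have [E1 E2] := Xx s Xs; have [E3 E4] := Xy s Xs.
  by rewrite rmulBl rmulBr E1 E2 E3 E4 subr0.
pose A' := [set x | A x /\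
    forall b c, A b -> A c -> x ** (b ** c) = 0 /\ (b ** c) ** x = 0].
have fA' : finite_index A' by exact: finite_index_annihilator_products AF.
have sA' : add_subgroup A'.
  split; first by split=> [|b c _ _]; rewrite ?rmulr0 ?rmul0r //; exact: sA.1.
  move=> x y [Ax Px] [Ay Py]; split=> [|b c Ab Ac]; first exact: sA.2.
  have [E1 E2] := Px b c Ab Ac; have [E3 E4] := Py b c Ab Ac.
  by rewrite rmulBl rmulBr E1 E2 E3 E4 subr0.
(* F' contains the products from A' and is annihilated by A' and by itself,
   hence A' + F' is a subring. *)
pose F' := F `&` annih A' `&` annih (annih A').
have sF' : add_subgroup F'.
  split; first by split; [split; [exact: sF.1|] |]; exact: (annihB _).1.
  move=> x y [[Fx Dx] Ex] [[Fy Dy] Ey].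
  by split; [split; [exact: sF.2|] |]; exact: (annihB _).2.
have A'F' x y : A' x -> A' y -> F' (x ** y).
  move=> [Ax Px] [Ay Py]; split; first split; first exact: AF.
    by move=> s [_ /(_ x y Ax Ay) []].
  (* By associativity, whatever annihilates [x] and [y] annihilates their product. *)
  move=> s Ds.
  have [_ E1] := Ds y (conj Ay Py); have [E2 _] := Ds x (conj Ax Px).
  by rewrite -rmulA E1 rmulr0 rmulA E2 rmul0r.
pose S := [set z | exists a f, [/\ A' a, F' f & z = a + f]].
(* All terms involving [f] or [g] vanish, leaving the product of [a] and [b]. *)
have SS x y : S x -> S y -> F' (x ** y).
  move=> [a [f [A'a F'f ->]]] [b [g [A'b F'g ->]]].
  rewrite rmulDr !rmulDl.
  have [E1 E2] := F'f.1.2 b A'b; have [E3 E4] := F'g.1.2 a A'a.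
  have [E5 _] := F'f.2 g F'g.1.2.
  by rewrite E1 E4 E5 !addr0; exact: A'F'.
have SF' x f : S x -> F' f -> x ** f = 0 /\ f ** x = 0.
  move=> [a [g [A'a F'g ->]]] F'f.
  have [E1 E2] := F'f.1.2 a A'a; have [E3 E4] := F'f.2 g F'g.1.2.
  by rewrite rmulDl rmulDr E1 E2 E3 E4 addr0.
have A'S : A' `<=` S.
  by move=> a A'a; exists a, 0; rewrite addr0; split=> //; exact: sF'.1.
have F'S : F' `<=` S.
  by move=> f F'f; exists 0, f; rewrite add0r; split=> //; exact: sA'.1.
have sS : subring S.
  apply/subringP; split; last by move=> x y Sx Sy; exact/F'S/SS.
  split=> [|x y [a [f [A'a F'f ->]]] [b [g [A'b F'g ->]]]]; first exact/A'S/sA'.1.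
  by exists (a - b), (f - g); split; [exact: sA'.2 | exact: sF'.2 | rewrite addrACA opprD].
have fS : finite_index S by case: fA' => T [f fP]; exists T, f => x y /fP /A'S.
have [I [Iid IS fI]] := finite_index_subring_ideal sS fS.
have [sI IM] := (ideal_inP I).1 Iid.
have SI : subring I by case: Iid.
exists I, (F' `&` I); split=> //.
- split=> //; last 1 first.
  + move=> i j Ii [F'j _]; have [-> ->] := SF' _ _ (IS _ Ii) F'j.
    by split; split; [exact: sF'.1 | exact: sI.1 | exact: sF'.1 | exact: sI.1].
  + apply/subringP; split.
      split; first by split; [exact: sF'.1 | exact: sI.1].
      by move=> x y [? ?] [? ?]; split; [exact: sF'.2 | exact: sI.2].
    move=> x y [F'x Ix] [F'y Iy]; split; last exact: (IM _ _ Iy).1.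
    by apply: SS; exact: F'S.
- exact: finite_index_rquotient.
- move=> x y Ix Iy.
  have xyJ : (F' `&` I) (x ** y).
    by split; [apply: SS; exact: IS | exact: (IM _ _ Iy).1].
  apply/seteqP; split=> _ [j [F'j Ij] <-].
    exists (x ** y + j); rewrite ?add0r //.
    by split; apply: add_subgroupD => //; case: xyJ.
  exists (- (x ** y) + j); last by rewrite addrA subrr.
  by split; apply: add_subgroupD => //; apply: add_subgroupN => //; case: xyJ.
split; first by do 3 apply: finite_setIl.
move=> f [F'f If]; split=> // s Is.
by have [-> ->] := SF' _ _ (IS _ Is) F'f.
Qed.

End FiniteIndexRing.

(** * Pulling subgroups back along homomorphisms from an additive group *)

Section SubgroupPreimage.
Variables (V : zmodType) (G : groupType) (h : V -> G) (H : set G).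
Hypothesis hD : {morph h : x y / x + y >-> (x * y)%g}.
Hypothesis sH : subgroup H.

Lemma additive_to_group0 : h 0 = 1%g.
Proof. by apply: (mulgI (h 0)); rewrite -hD addr0 mulg1. Qed.

Lemma additive_to_groupN x : h (- x) = (h x)^-1%g.
Proof. by apply: (mulgI (h x)); rewrite -hD subrr mulgV additive_to_group0. Qed.

Lemma add_subgroup_preimage : add_subgroup (h @^-1` H).
Proof.
case: sH => H1 HM HV; split=> [|x y Hx Hy] /=; first by rewrite additive_to_group0.
by rewrite hD additive_to_groupN; apply: HM => //; exact: HV.
Qed.

Lemma finite_index_preimage :
  finite_quotient [set: G] H -> finite_index (h @^-1` H).
Proof.
move=> /(finite_quotient_code sH) [T [f fP]]; exists T, (f \o h) => x y /esym /fP.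
by rewrite -additive_to_groupN -hD addrC.
Qed.

End SubgroupPreimage.

(** * The Heisenberg group of a ring *)

(* The triple (a, b, c) stands for the unitriangular matrix
   [[1, a, c], [0, 1, b], [0, 0, 1]]. *)
Definition heisenberg (R : rngType) : Type := (R * R * R)%type.

HB.instance Definition _ (R : rngType) := Choice.on (heisenberg R).

Section Heisenberg.
Variable R : rngType.
Local Notation "x ** y" := (@rmul R x y) (at level 40, left associativity).
Implicit Types x y z : heisenberg R.

Definition heis_mul x y : heisenberg R :=
  (x.1.1 + y.1.1, x.1.2 + y.1.2, x.2 + y.2 + x.1.1 ** y.1.2).
Definition heis_one : heisenberg R := (0, 0, 0).
Definition heis_inv x : heisenberg R :=
  (- x.1.1, - x.1.2, - x.2 + x.1.1 ** x.1.2).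

Lemma heis_mulA : associative heis_mul.
Proof.
move=> x y z; rewrite /heis_mul /= !addrA rmulDr rmulDl !addrA.
by congr pair; rewrite [LHS](ACl (1*2*5*3*6*4)).
Qed.

Lemma heis_mul1 : left_id heis_one heis_mul.
Proof. by case=> -[a b] c; rewrite /heis_mul /= !add0r rmul0r addr0. Qed.

Lemma heis_mulr1 : right_id heis_one heis_mul.
Proof. by case=> -[a b] c; rewrite /heis_mul /= !addr0 rmulr0 addr0. Qed.

Lemma heis_mulV : left_inverse heis_one heis_inv heis_mul.
Proof.
case=> -[a b] c; rewrite /heis_mul /heis_inv /= !addNr rmulNr.
by rewrite [_ + _ + c]addrAC addNr add0r subrr.
Qed.

Lemma heis_mulrV : right_inverse heis_one heis_inv heis_mul.
Proof.
case=> -[a b] c; rewrite /heis_mul /heis_inv /= !subrr rmulrN.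
by rewrite addrA subrr add0r subrr.
Qed.

HB.instance Definition _ := isGroup.Build (heisenberg R)
  heis_mulA heis_mul1 heis_mulr1 heis_mulV heis_mulrV.

Lemma heis_mulE x y :
  (x * y)%g = (x.1.1 + y.1.1, x.1.2 + y.1.2, x.2 + y.2 + x.1.1 ** y.1.2)
    :> heisenberg R.
Proof. by []. Qed.

Definition heis_coord x (i : 'I_3) : R :=
  match val i with 0 => x.1.1 | 1 => x.1.2 | _ => x.2 end.

(** The carrier is all of R^3, so the family of equations is empty, indexed by [void]. *)
Lemma definable_heisenberg (L : signature) (M : structure L) :
  definable_ring M R -> definable_group M (heisenberg R).
Proof.
move=> dR.
pose o0 : 'I_3 := inord 0; pose o1 : 'I_3 := inord 1; pose o2 : 'I_3 := inord 2.
pose m (k : 'I_3) (v : 'I_3 + 'I_3 -> R) : R :=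
  if val k is 2 then v (inl o2) + v (inr o2) + v (inl o0) ** v (inr o1)
  else v (inl k) + v (inr k).
apply: (@definable_algebraic_group _ _ R _ 'I_3 void heis_coord
          (fun _ _ => 0) (fun _ _ => 0) m) => //.
- move=> [[a b] c] [[a' b'] c'] /funeqP E.
  have := E o0; have := E o1; have := E o2.
  by rewrite /heis_coord /= !inordK //= => -> -> ->.
- move=> k; rewrite /m; case: (val k) => [|[|[|j]]];
    do ?[apply: polyfun_add | apply: polyfun_mul | apply: polyfun_var].
- move=> r; split=> // _; exists (r o0, r o1, r o2) => //.
  apply: funext => k; rewrite /heis_coord; case: k => -[|[|[|//]]] lt3 /=;
    by congr r; apply: val_inj; rewrite /= inordK.
- move=> x y [[|[|[|//]]] lt3] //=.
  by rewrite /m /heis_coord /= !inordK.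
Qed.

(** This central subgroup can be smaller than the centre, for instance when [R] is null and
    nonzero. *)
Lemma heis_normal_center :
  normal_in [set x : heisenberg R | x.1 = (0, 0)] [set: heisenberg R].
Proof.
split=> //; first split.
- by [].
- by move=> [[a b] c] [[a' b'] c'] /= [-> ->] [-> ->]; rewrite !addr0.
- by move=> [[a b] c] /= [-> ->]; rewrite !oppr0.
- move=> [[a b] c] [[a' b'] c'] /= [-> ->] _.
  by rewrite !addr0 !addNr.
Qed.

Lemma nilpotent_heisenberg : nilpotent_group (heisenberg R).
Proof.
exists 2, (fun i => match i with
  | 0 => [set: heisenberg R] | 1 => [set x : heisenberg R | x.1 = (0, 0)] | _ => [set 1%g] end).
have sub1 : subgroup [set 1%g : heisenberg R].
  by split=> // [x y -> ->|x ->]; rewrite /= ?mulg1 ?invg1.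
split=> //.
- move=> [|[|[|//]]] _; [|exact: heis_normal_center|].
    by split=> //; split.
  by split=> // k x -> _; rewrite /= mulg1 mulVg.
move=> [|[|//]] _; split=> //.
(* The products in the two orders differ by the central element with entry x_1 g_2 - g_1 x_2. *)
- move=> x g _; apply/seteqP; split=> _ [z /= z0 <-].
    exists (0, 0, z.2 + x.1.1 ** g.1.2 - g.1.1 ** x.1.2) => //.
    rewrite !heis_mulE z0 /= !addr0 !rmulr0 !addr0; congr (pair (pair _ _) _).
    + by rewrite addrC.
    + by rewrite addrC.
    + by rewrite !addrA [LHS](ACl (2*1*5*4*(3*6))) /= subrr addr0.
  exists (0, 0, z.2 + g.1.1 ** x.1.2 - x.1.1 ** g.1.2) => //.
  rewrite !heis_mulE z0 /= !addr0 !rmulr0 !addr0; congr (pair (pair _ _) _).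
  + by rewrite addrC.
  + by rewrite addrC.
  + by rewrite !addrA [LHS](ACl (2*1*5*4*(3*6))) /= subrr addr0.
- by move=> x ->.
- move=> [[a b] c] [[a' b'] c'] /= [-> ->]; congr left_coset.
  by rewrite !heis_mulE /= !addr0 !add0r rmul0r rmulr0 !addr0 addrC.
Qed.

(** [heis1], [heis2] and [heis3] are the elementary matrices e_12, e_23 and e_13. *)
Definition heis1 (a : R) : heisenberg R := (a, 0, 0).
Definition heis2 (b : R) : heisenberg R := (0, b, 0).
Definition heis3 (c : R) : heisenberg R := (0, 0, c).

Lemma heis1D : {morph heis1 : a b / a + b >-> (a * b)%g}.
Proof. by move=> a b; rewrite heis_mulE /= rmulr0 !addr0. Qed.

Lemma heis2D : {morph heis2 : a b / a + b >-> (a * b)%g}.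
Proof. by move=> a b; rewrite heis_mulE /= rmul0r !addr0. Qed.

Lemma heis3D : {morph heis3 : a b / a + b >-> (a * b)%g}.
Proof. by move=> a b; rewrite heis_mulE /= rmul0r !addr0. Qed.

Lemma heis12 a b : (heis1 a * heis2 b = heis2 b * heis1 a * heis3 (a ** b))%g.
Proof. by rewrite !heis_mulE /= !rmulr0 !addr0 !add0r. Qed.

End Heisenberg.

(** * From subgroups of the Heisenberg group to the ring *)

Section RingFromHeisenberg.
Variables (R : rngType) (H : set (heisenberg R)).
Hypotheses (sH : subgroup H) (fH : finite_quotient [set: heisenberg R] H).

(** The intersection allows an element to be used both as left and as right factor. *)
Definition heis_trace : set R := (@heis1 R @^-1` H) `&` (@heis2 R @^-1` H).

Lemma add_subgroup_heis_trace : add_subgroup heis_trace.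
Proof.
have [? A1] := add_subgroup_preimage (@heis1D R) sH.
have [? A2] := add_subgroup_preimage (@heis2D R) sH.
by split=> // x y [? ?] [? ?]; split; [exact: A1 | exact: A2].
Qed.

Lemma finite_index_heis_trace : finite_index heis_trace.
Proof.
apply: finite_index_setI; apply: finite_index_preimage => //.
  exact: heis1D.
exact: heis2D.
Qed.

End RingFromHeisenberg.

Lemma null_by_finite_of_heisenberg (R : rngType) :
  abelian_by_finite (heisenberg R) -> null_by_finite R.
Proof.
move=> [H [[sH _ _ _] abH fH]].
apply: (null_by_finite_of_subgroup (add_subgroup_heis_trace sH)
                                   (finite_index_heis_trace sH fH)).
(* Since e_12(x) and e_23(y) commute, their commutator e_13(xy) is trivial. *)
move=> x y [Hx _] [_ Hy]; have := abH _ _ Hx Hy.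
by rewrite heis12 -[RHS]mulg1 => /mulgI [].
Qed.

Lemma finnull_by_null_by_finite_of_heisenberg (R : rngType) :
  fincentral_by_abelian_by_finite (heisenberg R) -> finnull_by_null_by_finite R.
Proof.
move=> [H [K [[sH _ _ _] [sK _ _ _] fH abHK [finK _]]]].
apply: (finnull_by_null_by_finite_of_subgroup (A := heis_trace H)
          (F := @heis3 R @^-1` K)).
- exact: add_subgroup_heis_trace.
- exact: finite_index_heis_trace.
- exact: add_subgroup_preimage (@heis3D R) sK.
(* The entry z is recovered from e_13(z) by [snd], so finiteness passes from [K] to its preimage. *)
- apply: sub_finite_set (finite_image snd finK) => z Kz /=.
  by exists (heis3 z).
- move=> x y [Hx _] [_ Hy] /=.
  by have /(left_coset_eq sK) := abHK _ _ Hx Hy; rewrite heis12 mulKg.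
Qed.

(** * The adjoint group of a ring *)

Section AdjointGroup.
Variable S : rngType.
Implicit Types x y z : S.

(* 1 + circ x y = (1 + x)(1 + y) in any unital overring. *)
Definition circ x y : S := x + y + rmul x y.

Lemma circA : associative circ.
Proof.
move=> x y z; rewrite /circ !rmulDl !rmulDr !rmulA !addrA.
by rewrite [LHS](ACl (1*2*5*3*6*4*7)).
Qed.

Lemma circ0 : left_id 0 circ.
Proof. by move=> x; rewrite /circ rmul0r add0r addr0. Qed.

Lemma circr0 : right_id 0 circ.
Proof. by move=> x; rewrite /circ rmulr0 !addr0. Qed.

Definition circ_inverse (p : S * S) : bool :=
  (circ p.1 p.2 == 0) && (circ p.2 p.1 == 0).

(* A quasi-invertible element paired with its quasi-inverse, so that the
   carrier is cut out by equations. *)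
Definition adjoint : Type := {p : S * S | circ_inverse p}.

HB.instance Definition _ := Choice.on adjoint.

Lemma circ_inverse_mul (p q : adjoint) :
  circ_inverse (circ (val p).1 (val q).1, circ (val q).2 (val p).2).
Proof.
case: p q => -[a b] /= /andP [/= /eqP ab /eqP ba].
case=> -[c d] /= /andP [/= /eqP cd /eqP dc].
rewrite /circ_inverse /= -!circA [circ c (circ d b)]circA cd circ0 ab eqxx.
by rewrite [circ b (circ a c)]circA ba circ0 dc eqxx.
Qed.

Lemma circ_inverse_swap (p : adjoint) : circ_inverse ((val p).2, (val p).1).
Proof. by case: p => -[a b] /= /andP [ab ba]; rewrite /circ_inverse ab ba. Qed.

Lemma circ_inverse_one : circ_inverse (0, 0).
Proof. by rewrite /circ_inverse circ0 eqxx. Qed.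

Definition adjoint_mul (p q : adjoint) : adjoint :=
  @exist (S * S) circ_inverse _ (circ_inverse_mul p q).
Definition adjoint_inv (p : adjoint) : adjoint :=
  @exist (S * S) circ_inverse _ (circ_inverse_swap p).
Definition adjoint_one : adjoint := @exist (S * S) circ_inverse _ circ_inverse_one.

Lemma adjoint_mulA : associative adjoint_mul.
Proof. by move=> p q r; apply: val_inj; rewrite /= !circA. Qed.

Lemma adjoint_mul1 : left_id adjoint_one adjoint_mul.
Proof. by move=> p; apply: val_inj; rewrite /= circ0 circr0; case: (val p). Qed.

Lemma adjoint_mulr1 : right_id adjoint_one adjoint_mul.
Proof. by move=> p; apply: val_inj; rewrite /= circ0 circr0; case: (val p). Qed.

Lemma adjoint_mulV : left_inverse adjoint_one adjoint_inv adjoint_mul.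
Proof.
by case=> -[a b] H; apply: val_inj; case/andP: (H) => /= _ /eqP /= ->.
Qed.

Lemma adjoint_mulrV : right_inverse adjoint_one adjoint_inv adjoint_mul.
Proof.
by case=> -[a b] H; apply: val_inj; case/andP: (H) => /= /eqP /= ->.
Qed.

HB.instance Definition _ := isGroup.Build adjoint
  adjoint_mulA adjoint_mul1 adjoint_mulr1 adjoint_mulV adjoint_mulrV.

Lemma adjoint_valM (p q : adjoint) :
  val (p * q)%g = (circ (val p).1 (val q).1, circ (val q).2 (val p).2).
Proof. by []. Qed.

(** A left and a right quasi-inverse of the same element agree, so the second component is
    determined. *)
Lemma adjoint_fst_inj (p q : adjoint) : (val p).1 = (val q).1 -> p = q.
Proof.
move=> E; apply: val_inj; rewrite [LHS]surjective_pairing [RHS]surjective_pairing.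
congr pair => //.
case: p q E => -[a b] /= /andP [_ /eqP /= ba] [[a' b'] /= /andP [/eqP /= ab' _]] E.
by rewrite -[LHS]circr0 -ab' -E circA ba circ0.
Qed.

End AdjointGroup.

(** * Matrices over a ring without identity *)

Section Matrices.
Variables (R : rngType) (n : nat).
Local Notation "x ** y" := (@rmul R x y) (at level 40, left associativity).
Implicit Types A B C : 'M[R]_n.

Lemma rmul_suml (I : Type) (s : seq I) (f : I -> R) x :
  (\sum_(i <- s) f i) ** x = \sum_(i <- s) f i ** x.
Proof.
by elim: s => [|i s IH]; rewrite ?big_nil ?rmul0r // !big_cons rmulDl IH.
Qed.

Lemma rmul_sumr (I : Type) (s : seq I) (f : I -> R) x :
  x ** (\sum_(i <- s) f i) = \sum_(i <- s) x ** f i.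
Proof.
by elim: s => [|i s IH]; rewrite ?big_nil ?rmulr0 // !big_cons rmulDr IH.
Qed.

Definition rmulmx A B : 'M[R]_n := \matrix_(i, j) \sum_k A i k ** B k j.

Lemma rmulmxA : associative rmulmx.
Proof.
move=> A B C; apply/matrixP => i j; rewrite !mxE.
under eq_bigr do rewrite mxE rmul_sumr.
rewrite exchange_big; apply: eq_bigr => k _; rewrite mxE rmul_suml.
by apply: eq_bigr => l _; rewrite rmulA.
Qed.

Lemma rmulmxDl : left_distributive rmulmx +%R.
Proof.
move=> A B C; apply/matrixP => i j; rewrite !mxE -big_split.
by apply: eq_bigr => k _; rewrite mxE rmulDl.
Qed.

Lemma rmulmxDr : right_distributive rmulmx +%R.
Proof.
move=> A B C; apply/matrixP => i j; rewrite !mxE -big_split.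
by apply: eq_bigr => k _; rewrite mxE rmulDr.
Qed.

HB.instance Definition _ :=
  Zmodule_isRng.Build 'M[R]_n rmulmxA rmulmxDl rmulmxDr.

Lemma rmulmxE A B i j : rmul A B i j = \sum_k A i k ** B k j.
Proof. by rewrite mxE. Qed.

Definition unit_mx (i j : 'I_n) (a : R) : 'M[R]_n :=
  \matrix_(k, l) if (k == i) && (l == j) then a else 0.

Lemma unit_mxD i j : {morph unit_mx i j : a b / a + b}.
Proof.
by move=> a b; apply/matrixP => k l; rewrite !mxE; case: ifP => //; rewrite addr0.
Qed.

Lemma unit_mx_mul i j k l a b :
  rmul (unit_mx i j a) (unit_mx k l b) =
  if j == k then unit_mx i l (a ** b) else 0.
Proof.
apply/matrixP => s t; rewrite rmulmxE (bigD1 j) //= big1 => [|m mj]; last first.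
  by rewrite mxE (negPf mj) andbF rmul0r.
rewrite !mxE !eqxx andbT addr0.
by case: (j == k); rewrite !mxE; case: (s == i); case: (t == l);
  rewrite ?rmul0r ?rmulr0.
Qed.

End Matrices.

(** The index [(true, i, j)] stands for an entry of the matrix, [(false, i, j)] for one of its
    quasi-inverse. *)
Lemma definable_adjoint_matrices (L : signature) (M : structure L) (R : rngType)
    (n : nat) : definable_ring M R -> definable_group M (adjoint 'M[R]_n).
Proof.
move=> dR; pose K := (bool * 'I_n * 'I_n)%type.
pose part (p : 'M[R]_n * 'M[R]_n) (b : bool) := if b then p.1 else p.2.
pose g (x : adjoint 'M[R]_n) (v : K) : R := part (val x) v.1.1 v.1.2 v.2.
pose cmul (X : Type) (u w : 'I_n -> 'I_n -> X) i j (r : X -> R) :=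
  r (u i j) + r (w i j) + \sum_k rmul (r (u i k)) (r (w k j)).
have cmulP X u w i j : polyfun (@cmul X u w i j).
  apply: polyfun_add; first by apply: polyfun_add; exact: polyfun_var.
  by apply: polyfun_sum => k; apply: polyfun_mul; exact: polyfun_var.
have cmulE X u w i j r : @cmul X u w i j r =
    circ (\matrix_(k, l) r (u k l)) (\matrix_(k, l) r (w k l)) i j.
  rewrite /circ !mxE; congr (_ + _); apply: eq_bigr => k _; by rewrite !mxE.
pose coord b (i j : 'I_n) : K := (b, i, j).
(* The equations say that both circle products of the two halves vanish. Quasi-inverses multiply in
   the reverse order. *)
apply: (@definable_algebraic_group _ _ R _ K K g
  (fun e => cmul _ (coord e.1.1) (coord (~~ e.1.1)) e.1.2 e.2) (fun _ _ => 0)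
  (fun v => if v.1.1
     then cmul _ (fun i j => inl (true, i, j)) (fun i j => inr (true, i, j)) v.1.2 v.2
     else cmul _ (fun i j => inr (false, i, j)) (fun i j => inl (false, i, j)) v.1.2 v.2)).
- exact: dR.
- move=> x y /funeqP E; apply: adjoint_fst_inj; apply/matrixP => i j.
  exact: (E (true, i, j)).
- by move=> e; exact: cmulP.
- by move=> e; exact: polyfun_zero.
- by move=> [[[] i] j]; exact: cmulP.
- move=> r; split=> [[x _ <-] [[b i] j]|H].
    rewrite cmulE.
    have E d : (\matrix_(k, l) g x (coord d k l)) = part (val x) d.
      by apply/matrixP => k l; rewrite mxE.
    rewrite !E; case: (val x) (valP x) => A B /andP [/= /eqP AB /eqP BA].
    by case: b; rewrite /part /= ?AB ?BA mxE.
  pose A d : 'M[R]_n := \matrix_(k, l) r (coord d k l).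
  have AA d : circ (A d) (A (~~ d)) = 0.
    by apply/matrixP => i j; rewrite -cmulE (H (d, i, j)) mxE.
  have AP : circ_inverse (A true, A false).
    by rewrite /circ_inverse /= (AA true) (AA false) !eqxx.
  exists (@exist _ (@circ_inverse _) _ AP) => //; apply: funext => -[[d i] j].
  by rewrite /g /part /=; case: d; rewrite mxE.
- move=> x y [[d i] j]; case: d; rewrite /= cmulE /g /part /=;
  congr ((circ _ _ : 'M[R]_n) i j); by apply/matrixP => k l; rewrite mxE.
Qed.

(** * Elementary matrices and their commutators *)

Section Transvections.
Variable R : rngType.
Local Notation "x ** y" := (@rmul R x y) (at level 40, left associativity).

Definition offdiag : Type := {p : 'I_3 * 'I_3 | p.1 != p.2}.

HB.instance Definition _ := Finite.on offdiag.

Lemma offdiag_neq (p : offdiag) : ((val p).2 == (val p).1) = false.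
Proof. by rewrite eq_sym (negPf (valP p)). Qed.

(** Off the diagonal a E_ij has square zero, so 1 - a E_ij inverts 1 + a E_ij. *)
Lemma transvection_inverse (p : offdiag) (a : R) :
  circ_inverse (unit_mx (val p).1 (val p).2 a, unit_mx (val p).1 (val p).2 (- a)).
Proof.
have D b c : unit_mx (val p).1 (val p).2 b + unit_mx (val p).1 (val p).2 c
             = unit_mx (val p).1 (val p).2 (b + c) :> 'M[R]_3 by rewrite unit_mxD.
have U0 : unit_mx (val p).1 (val p).2 0 = 0 :> 'M[R]_3.
  by apply/matrixP => i j; rewrite !mxE; case: ifP.
rewrite /circ_inverse /= /circ !unit_mx_mul offdiag_neq !addr0 !D.
by rewrite subrr addNr U0 eqxx.
Qed.

Definition transvection (p : offdiag) (a : R) : adjoint 'M[R]_3 :=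
  @exist _ (@circ_inverse _) _ (transvection_inverse p a).

Lemma transvectionD p : {morph transvection p : a b / a + b >-> (a * b)%g}.
Proof.
move=> a b; apply: adjoint_fst_inj.
by rewrite adjoint_valM /= /circ unit_mx_mul offdiag_neq addr0 unit_mxD.
Qed.

Lemma transvection_eq1 p a : transvection p a = 1%g -> a = 0.
Proof.
move=> /(congr1 (fun x : adjoint 'M[R]_3 => (val x).1 (val p).1 (val p).2)).
by rewrite /= !mxE !eqxx.
Qed.

(** Among three indices there is a [j] other than [i] and [k], and e_ik(ab) = [e_ij(a), e_jk(b)].
    The positions [q] and [r] depend on [p] only. *)
Lemma transvection_product (p : offdiag) :
  exists q r : offdiag, forall a b,
    (transvection p (a ** b) =
     transvection q a * transvection r b * (transvection q a)^-1
       * (transvection r b)^-1)%g.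
Proof.
case: p => -[i k] /= ik.
have [j ij jk] : exists2 j, i != j & j != k.
  have /card_gt0P [j] : (0 < #|(~: [set i; k])%SET|)%N.
    by rewrite -(leq_add2l #|[set i; k]%SET|) cardsC card_ord cards2; case: (_ != _).
  by rewrite !inE negb_or => /andP [ji jk]; exists j; rewrite // eq_sym.
exists (@exist _ (fun p => p.1 != p.2) (i, j) ij).
exists (@exist _ (fun p => p.1 != p.2) (j, k) jk) => a b.
(* Clearing the inverses leaves e_ik(ab) e_jk(b) e_ij(a) = e_ij(a) e_jk(b). *)
apply: (mulIg (transvection (exist _ (j, k) jk) b)); rewrite mulgVK.
apply: (mulIg (transvection (exist _ (i, j) ij) a)); rewrite mulgVK.
apply: adjoint_fst_inj; rewrite !adjoint_valM /= /circ !rmulDl !unit_mx_mul.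
rewrite eqxx [k == j]eq_sym [k == i]eq_sym (negPf ik) (negPf jk) !addr0.
by rewrite rmul0r !addr0 [LHS](ACl (3*2*1)).
Qed.

End Transvections.

(** The successor arises because [rprod r m] has m + 1 factors. *)
Lemma rprod_cat (R : rngType) (r : nat -> R) (m k : nat) :
  rprod r (m + k).+1 = rmul (rprod r m) (rprod (fun i => r (m.+1 + i)%N) k).
Proof.
elim: k => [|k IH]; first by rewrite addn0 /= addn0.
by rewrite addnS /= -/(rprod r (m + k).+1) IH rmulA addSn addnS.
Qed.

(** A product of 2^n factors is halved repeatedly, each multiplication of two halves going one step
    down the series. *)
Lemma rprod_derived (R : rngType) (n : nat) (D : nat -> set R) (r : nat -> R) :
  (forall i, (i < n)%N -> forall x y, D i x -> D i y -> D i.+1 (rmul x y)) ->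
  (forall i, D 0 (r i)) -> D n (rprod r (2 ^ n).-1).
Proof.
move=> DM; elim: n DM r => [|n IH] DM r Dr; first exact: Dr.
have -> : (2 ^ n.+1).-1 = ((2 ^ n).-1 + (2 ^ n).-1).+1.
  by rewrite expnS mul2n -addnn -[in LHS](prednK (expn_gt0 2 n)) addnS.
rewrite rprod_cat.
have DM' i : (i < n)%N -> forall x y, D i x -> D i y -> D i.+1 (rmul x y).
  by move=> lin; apply: DM; exact: ltnW.
by apply: DM => //; exact: IH.
Qed.

(** * From subgroups of the adjoint group to the ring *)

Section RingFromAdjoint.
Variable R : rngType.
Implicit Types H K : set (adjoint 'M[R]_3).

(** All positions are required at once, since a commutator at one position involves two others. *)
Definition transvection_trace H : set R :=
  [set a | forall p, H (transvection p a)].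

Lemma ideal_transvection_trace H :
  normal_in H [set: adjoint 'M[R]_3] -> ideal_in (transvection_trace H) [set: R].
Proof.
move=> [sH _ _ nH]; have [_ HM HV] := sH; apply/ideal_inP; split.
  have sT p := add_subgroup_preimage (@transvectionD R p) sH.
  by split=> [p|x y Hx Hy p]; [exact: (sT p).1 | apply: (sT p).2].
have conjH g h : H g -> H (h * g * h^-1)%g.
  by move=> Hg; rewrite -{1}[h]invgK; exact: nH.
(* For ra the commutator is a conjugate of e_s(a) times e_s(a)^-1; for ar it is e_q(a) times a
   conjugate of its inverse. *)
move=> r a Ha; split=> p; have [q [s ->]] := transvection_product R p.
  by apply: HM; [apply: conjH; exact: Ha | exact/HV/Ha].
rewrite -!mulgA; apply: HM; first exact: Ha.
by rewrite mulgA; apply: conjH; exact/HV/Ha.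
Qed.

Lemma finite_index_transvection_trace H :
  subgroup H -> finite_quotient [set: adjoint 'M[R]_3] H ->
  finite_index (transvection_trace H).
Proof.
move=> sH fH; apply: finite_index_all => p.
exact: finite_index_preimage (@transvectionD R p) sH fH.
Qed.

Lemma transvection_trace_commutator H K :
  subgroup H -> subgroup K -> abelian_quotient H K ->
  forall x y, transvection_trace H x -> transvection_trace H y ->
    transvection_trace K (rmul x y).
Proof.
move=> [_ _ HV] sK abHK x y Hx Hy p; have [q [s ->]] := transvection_product R p.
(* The left cosets yield x^-1 y^-1 x y in [K]; inserting inverses turns this into the required form
   of the commutator. *)
have := abHK _ _ (HV _ (Hx q)) (HV _ (Hy s)).
by move=> /(left_coset_eq sK); rewrite invgM !invgK !mulgA.
Qed.

(** The traces of the terms of the solvable series form a descent for products; the trace of the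
    trivial group is zero, read off at the position [(ord0, ord_max)]. *)
Lemma nilpotent_transvection_trace H :
  solvable_subgroup H -> nilpotent_subring (transvection_trace H).
Proof.
move=> [n [K [K0 Kn Kab]]]; exists (2 ^ n).-1 => r Hr.
have : transvection_trace (K n) (rprod r (2 ^ n).-1).
  apply: (rprod_derived (D := fun i => transvection_trace (K i))); last by rewrite K0.
  move=> i /Kab [[sK' sK _ _] abK]; exact: transvection_trace_commutator.
rewrite Kn; have i01 : (ord0 : 'I_3) != ord_max by [].
by move=> /(_ (@exist _ (fun p => p.1 != p.2) (_, _) i01)) /transvection_eq1.
Qed.

Lemma nilpotent_by_finite_of_adjoint :
  solvable_by_finite (adjoint 'M[R]_3) -> nilpotent_by_finite R.
Proof.
move=> [H [nH solH fH]]; have [sH _ _ _] := nH.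
have idT := ideal_transvection_trace nH.
exists (transvection_trace H); split=> //; first exact: nilpotent_transvection_trace.
apply: finite_index_rquotient; first by case/ideal_inP: idT.
exact: finite_index_transvection_trace.
Qed.

End RingFromAdjoint.

Theorem theorem3p1 (L : signature) (M : structure L) :
  ((forall G : groupType, definable_group M G -> solvable_by_finite G) ->
   forall R : rngType, definable_ring M R ->
     has_identity R \/ finite_characteristic R -> nilpotent_by_finite R)
  /\
  ((forall G : groupType, definable_group M G -> nilpotent_group G ->
      abelian_by_finite G) ->
   forall R : rngType, definable_ring M R -> null_by_finite R)
  /\
  ((forall G : groupType, definable_group M G -> nilpotent_group G ->
      fincentral_by_abelian_by_finite G) ->
   forall R : rngType, definable_ring M R -> finnull_by_null_by_finite R).
Proof.
split; [|split] => groups R dR.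
- by move=> _; apply/nilpotent_by_finite_of_adjoint/groups/definable_adjoint_matrices.
- apply/null_by_finite_of_heisenberg/groups; last exact: nilpotent_heisenberg.
  exact: definable_heisenberg.
- apply/finnull_by_null_by_finite_of_heisenberg/groups; last exact: nilpotent_heisenberg.
  exact: definable_heisenberg.
Qed.
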